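(* Let $q\ge2$, $\ell\ge1$, $t\ge1$, $n\ge1$ be integers. The maximum cardinality $A^{\tau_\ell}(n,t)$ of a code in $\mathbb{Z}_q^n$ that is $t$-tandem duplication (length $\ell$) correcting satisfies \[ A^{\tau_\ell}(n,t)\le \sum_{i=0}^{t}\left|\mathrm{IRR}^{\tau_\ell}_t\cap\mathbb{Z}_q^{n-i\ell}\right|+\sum_{i=1}^{i_{\max}}\frac{N^{\tau_\ell^D}_t(n-t\ell,i)}{i},\] where $N^{\tau_\ell^D}_t(m,i)=|\{\boldsymbol{x}\in\mathbb{Z}_q^m:|S^{\tau_\ell^D}_t(\boldsymbol{x})|=i\}|$ and $i_{\max}$ is the maximum error sphere size $|S_t^{\tau_\ell^D}(\boldsymbol{x})|$ for $t$ tandem deletion errors (over $\boldsymbol{x}\in\mathbb{Z}_q^{n-t\ell}$).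
   Context: Words are vectors over $\mathbb{Z}_q$; $\mathbb{Z}_q^m$ is regarded as empty for $m<0$; $|\boldsymbol{x}|$ is the length of a word. Tandem duplication of length $\ell$ at position $p$ ($0\le p\le |\boldsymbol{x}|-\ell$): if $\boldsymbol{x}=(\boldsymbol{u}\boldsymbol{v}\boldsymbol{w})$ with $|\boldsymbol{u}|=p$, $|\boldsymbol{v}|=\ell$, then $\tau_\ell(\boldsymbol{x},p)=(\boldsymbol{u}\boldsymbol{v}\boldsymbol{v}\boldsymbol{w})$. Tandem deletion of length $\ell$ at position $p$ ($0\le p\le |\boldsymbol{x}|-2\ell$): defined only if $\boldsymbol{x}=(\boldsymbol{u}\boldsymbol{v}\boldsymbol{v}\boldsymbol{w})$ with $|\boldsymbol{u}|=p$, $|\boldsymbol{v}|=\ell$, and then $\tau^D_\ell(\boldsymbol{x},p)=(\boldsymbol{u}\boldsymbol{v}\boldsymbol{w})$. For $\epsilon\in\{\tau_\ell,\tau^D_\ell\}$, the sphere $S^\epsilon_t(\boldsymbol{x})$ (resp. ball $B^\epsilon_t(\boldsymbol{x})$) is the set of all words obtained from $\boldsymbol{x}$ by exactly $t$ (resp. at most $t$) successive errors of type $\epsilon$, each applied at a position where it is defined. A code $\mathcal{C}\subseteq\mathbb{Z}_q^n$ is $t$-tandem duplication correcting (length $\ell$) if $B^{\tau_\ell}_t(\boldsymbol{c}_1)\cap B^{\tau_\ell}_t(\boldsymbol{c}_2)=\emptyset$ for all distinct $\boldsymbol{c}_1,\boldsymbol{c}_2\in\mathcal{C}$. The set of $t$-irreducible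 words is $\mathrm{IRR}^{\tau_\ell}_t=\{\boldsymbol{\nu}\in\mathbb{Z}_q^*: S^{\tau_\ell^D}_t(\boldsymbol{\nu})=\emptyset\}$, where $\mathbb{Z}_q^*$ is the set of all finite words over $\mathbb{Z}_q$. *)

(* Defs.v *)
From HB Require Import structures.
From mathcomp Require Import all_boot all_order all_algebra finmap.

Set Implicit Arguments.
Unset Strict Implicit.
Unset Printing Implicit Defensive.

Import Order.TTheory GRing.Theory Num.Theory.

Local Open Scope fset_scope.

Section Errors.
Variable T : choiceType.

(* An error maps a word and a position to the corrupted word, or to [None] if
   the error is not defined at that position. *)
Definition error := seq T -> nat -> option (seq T).

Definition tandem_dup (l : nat) : error := fun x p =>
  if p + l <= size x then
    let v := take l (drop p x) in
    Some (take p x ++ v ++ v ++ drop (p + l) x)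
  else None.

Definition tandem_del (l : nat) : error := fun x p =>
  let v := take l (drop p x) in
  if (p + l.*2 <= size x) && (take l (drop (p + l) x) == v) then
    Some (take p x ++ v ++ drop (p + l.*2) x)
  else None.

Lemma tandem_dupP l x p y :
  tandem_dup l x p = Some y <->
  exists u v w, [/\ x = u ++ v ++ w, size u = p, size v = l
                  & y = u ++ v ++ v ++ w].
Proof.
rewrite /tandem_dup; split.
  case: ifP => // le_px [<-].
  exists (take p x), (take l (drop p x)), (drop (p + l) x); split=> //.
  - by rewrite addnC -drop_drop !cat_take_drop.
  - by rewrite size_takel // (leq_trans (leq_addr l p)).
  - by rewrite size_takel // size_drop leq_subRL // (leq_trans (leq_addr l p)).
case=> u [v [w [-> <- <- ->]]].
rewrite !size_cat addnA leq_addr take_size_cat // drop_size_cat //.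
by rewrite take_size_cat // addnC -drop_drop !drop_size_cat.
Qed.

Lemma tandem_delP l x p y :
  tandem_del l x p = Some y <->
  exists u v w, [/\ x = u ++ v ++ v ++ w, size u = p, size v = l
                  & y = u ++ v ++ w].
Proof.
rewrite /tandem_del -addnn; split.
  case: ifP => // /andP[le_px /eqP eq_v] [<-].
  have le_p : p <= size x by rewrite (leq_trans (leq_addr _ _) le_px).
  exists (take p x), (take l (drop p x)), (drop (p + (l + l)) x); split=> //.
  - have drop2E : drop (p + l)%N x = take l (drop p x) ++ drop (p + (l + l))%N x.
      by rewrite -eq_v addnCA -[drop (l + _)%N x]drop_drop cat_take_drop.
    by rewrite -drop2E addnC -drop_drop !cat_take_drop.
  - by rewrite size_takel.
  - rewrite size_takel // size_drop leq_subRL //.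
    by rewrite (leq_trans _ le_px) // leq_add2l leq_addr.
case=> u [v [w [-> <- <- ->]]].
have dropE : drop (size u + size v)%N (u ++ v ++ v ++ w) = v ++ w.
  by rewrite addnC -drop_drop !drop_size_cat.
have -> : drop (size u + (size v + size v))%N (u ++ v ++ v ++ w) = w.
  by rewrite addnCA -[LHS]drop_drop dropE drop_size_cat.
by rewrite dropE !size_cat !addnA leq_addr drop_size_cat // !take_size_cat ?eqxx.
Qed.

(* Both errors are undefined at positions beyond the length of the word, so the
   range of [p] below is exhaustive. *)
Definition one_error (e : error) (x : seq T) : {fset seq T} :=
  [fset y in pmap (e x) (iota 0 (size x).+1)].

Lemma one_error_dupP l x y :
  reflect (exists p, tandem_dup l x p = Some y)
          (y \in one_error (tandem_dup l) x).
Proof.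
rewrite !inE mem_pmap; apply: (iffP mapP) => [[p _ ->]|[p E]]; first by exists p.
exists p => //; rewrite mem_iota /= ltnS; move: E; rewrite /tandem_dup.
by case: ifP => // /(leq_trans (leq_addr _ _)).
Qed.

Lemma one_error_delP l x y :
  reflect (exists p, tandem_del l x p = Some y)
          (y \in one_error (tandem_del l) x).
Proof.
rewrite !inE mem_pmap; apply: (iffP mapP) => [[p _ ->]|[p E]]; first by exists p.
exists p => //; rewrite mem_iota /= ltnS; move: E; rewrite /tandem_del.
by case: ifP => // /andP[/(leq_trans (leq_addr _ _))].
Qed.

Fixpoint sphere (e : error) (t : nat) (x : seq T) : {fset seq T} :=
  if t is s.+1 then \bigcup_(y <- sphere e s x) one_error e y else [fset x].

Definition ball (e : error) (t : nat) (x : seq T) : {fset seq T} :=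
  \bigcup_(s <- iota 0 t.+1) sphere e s x.

Definition dup_correcting (l t : nat) (C : {fset seq T}) : bool :=
  all2rel (fun c1 c2 => (c1 != c2) ==>
    (ball (tandem_dup l) t c1 `&` ball (tandem_dup l) t c2 == fset0)) C.

Definition IRR (l t : nat) : pred (seq T) :=
  [pred x | sphere (tandem_del l) t x == fset0].

End Errors.

(* The length is an integer, since [n - i * l] may be negative; there are then
   no words.  The alphabet ['Z_q] has [q] letters only if [1 < q]. *)
Definition words (q : nat) (m : int) : {fset seq 'Z_q} :=
  if m is Posz k then [fset val x | x in {: k.-tuple 'Z_q}] else fset0.

Lemma in_words q (m : int) (x : seq 'Z_q) :
  (x \in words q m) = ((size x)%:Z == m)%R.
Proof.
case: m => [k|k] /=; last by rewrite inE.
apply/imfsetP/idP => [[y _ ->]|/eqP[E]]; first by rewrite size_tuple.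
by exists (tcast E (in_tuple x)); rewrite // val_tcast.
Qed.

Definition max_code_size (q l n t : nat) : nat :=
  \max_(C <- fpowerset (words q n%:Z) | dup_correcting l t C) #|` C|.

Definition irr_count (q l t : nat) (m : int) : nat :=
  #|` [fset x in words q m | x \in IRR l t]|.

Definition del_sphere_count (q l t : nat) (m : int) (i : nat) : nat :=
  #|` [fset x in words q m | #|` sphere (tandem_del l) t x| == i]|.

Definition max_del_sphere (q l t : nat) (m : int) : nat :=
  \max_(x <- words q m) #|` sphere (tandem_del l) t x|.

(* Main.v *)
(** Tandem duplications of a fixed length commute up to a shift, so two words
    with a common word in their deletion balls also have a common word in their
    duplication balls: the deletion balls around the codewords are disjoint.
    Replacing each letter that equals the letter [l] places before it by a blank
    turns a tandem deletion into the removal of [l] consecutive blanks; inserting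
    [l] blanks into a fixed run commutes with such removals, hence [t]-fold
    deletion spheres do not grow along deletions.  Weight 1 on irreducible words
    and the inverse sphere size on the other words of length [n - t * l] thus
    gives total weight at least 1 to the deletion ball of every codeword. *)

Require Import Defs.
From mathcomp Require Import all_boot all_order all_algebra finmap.

Set Implicit Arguments.
Unset Strict Implicit.
Unset Printing Implicit Defensive.

Import Order.TTheory GRing.Theory Num.Theory.

(** * Spheres, and deletion as reversed duplication *)

Lemma sphereSrP (T : choiceType) (e : error T) t x y :
  reflect (exists2 z, z \in sphere e t x & y \in one_error e z)
          (y \in sphere e t.+1 x).
Proof.
apply: (iffP (bigfcupP _ _ _ _)) => -[z]; first by rewrite andbT; exists z.
by exists z; rewrite ?andbT.
Qed.

Lemma sphereSlP (T : choiceType) (e : error T) t x y :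
  reflect (exists2 z, z \in one_error e x & y \in sphere e t z)
          (y \in sphere e t.+1 x).
Proof.
elim: t x y => [|t IHt] x y.
  apply: (iffP (sphereSrP _ _ _ _)) => [[z /fset1P-> ?]|[z ? /fset1P->]].
    by exists y => //; apply: fset11.
  by exists x => //; apply: fset11.
apply: (iffP (sphereSrP _ _ _ _)) => [[z /IHt[z' z'x zz'] yz]|[z zx]].
  by exists z' => //; apply/sphereSrP; exists z.
by case/sphereSrP=> z' z'z yz'; exists z' => //; apply/IHt; exists z.
Qed.

Lemma mem_ball (T : choiceType) (e : error T) s t x y :
  s <= t -> y \in sphere e s x -> y \in ball e t x.
Proof. by move=> st yx; apply/bigfcupP; exists s; rewrite // mem_iota andbT. Qed.

Lemma one_error_del_dup (T : choiceType) l (x y : seq T) :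
  (y \in one_error (tandem_del l) x) = (x \in one_error (tandem_dup l) y).
Proof.
apply/one_error_delP/one_error_dupP.
  by case=> p /tandem_delP[u [v [w [-> up vl ->]]]]; exists p; apply/tandem_dupP;
     exists u, v, w.
by case=> p /tandem_dupP[u [v [w [-> up vl ->]]]]; exists p; apply/tandem_delP;
   exists u, v, w.
Qed.

(** Reversing a chain of errors turns its first step into the last one, so the two chains are
    unfolded at opposite ends. *)
Lemma sphere_del_dup (T : choiceType) l t (x y : seq T) :
  (y \in sphere (tandem_del l) t x) = (x \in sphere (tandem_dup l) t y).
Proof.
elim: t x y => [|t IHt] x y; first by rewrite !inE eq_sym.
by apply/sphereSlP/sphereSrP => -[z]; exists z;
  rewrite 1?IHt 1?one_error_del_dup // -?IHt -?one_error_del_dup.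
Qed.

(** * Confluence of tandem duplications *)

Lemma dup_diamond (T : choiceType) l (x a b : seq T) :
  a \in one_error (tandem_dup l) x -> b \in one_error (tandem_dup l) x ->
  exists2 z, z \in one_error (tandem_dup l) a & z \in one_error (tandem_dup l) b.
Proof.
move=> /one_error_dupP[p /tandem_dupP[u [v [w [xE _ vl ->]]]]].
move=> /one_error_dupP[p' /tandem_dupP[u' [v' [w' [xE' _ vl' ->]]]]] {p p'}.
wlog le_u : u v w u' v' w' xE vl xE' vl' / size u <= size u' => [ih|].
  case/orP: (leq_total (size u) (size u')) => le_u; first exact: (ih u v w).
  by have [z] := ih _ _ _ _ _ _ xE' vl' xE vl le_u; exists z.
have u'E : u' = u ++ drop (size u) u'.
  by rewrite -{1}[u'](cat_take_drop (size u)) -(takel_cat (v' ++ w') le_u) -xE'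
             xE take_size_cat.
move: (drop _ _) u'E => r u'E {le_u}; subst u'.
have sE : v ++ w = r ++ v' ++ w'.
  by move: xE; rewrite xE' -!catA => /eqP; rewrite eqseq_cat // eqxx => /eqP.
(* Since [r ++ v'] has length at least [l], it begins with [v], whether or not the two blocks
   overlap. *)
have rE : r ++ v' = v ++ drop l (r ++ v').
  rewrite -{1}[r ++ v'](cat_take_drop l); congr (_ ++ _).
  rewrite -(@takel_cat l _ (r ++ v') w'); last by rewrite size_cat vl' leq_addl.
  by rewrite -catA -sE -vl take_size_cat.
(* Both duplications at once: the left one shifts the right block by [l], the right one leaves the
   left block in place. *)
exists (u ++ v ++ r ++ v' ++ v' ++ w').
  apply/one_error_dupP; exists (size (u ++ v ++ r)); apply/tandem_dupP.
  by exists (u ++ v ++ r), v', w'; rewrite -!catA sE vl'.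
apply/one_error_dupP; exists (size u); apply/tandem_dupP.
exists u, v, (drop l (r ++ v') ++ v' ++ w'); split=> //.
  by rewrite (catA v) -rE -!catA.
by rewrite (catA v (drop _ _)) -rE -!catA.
Qed.

Lemma dup_confluent (T : choiceType) l i j (x a b : seq T) :
  a \in sphere (tandem_dup l) i x -> b \in sphere (tandem_dup l) j x ->
  exists2 z, z \in sphere (tandem_dup l) j a & z \in sphere (tandem_dup l) i b.
Proof.
have strip k (y c d : seq T) : c \in one_error (tandem_dup l) y ->
    d \in sphere (tandem_dup l) k y ->
    exists2 z, z \in sphere (tandem_dup l) k c & z \in one_error (tandem_dup l) d.
  elim: k y c d => [|k IHk] y c d cy; first by move/fset1P->; exists c => //; apply: fset11.
  case/sphereSlP=> d' d'y dd'; have [z zc zd'] := dup_diamond cy d'y.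
  have [z' z'z z'd] := IHk _ _ _ zd' dd'.
  by exists z' => //; apply/sphereSlP; exists z.
elim: i x a b => [|i IHi] x a b; first by move/fset1P-> => ?; exists b => //; apply: fset11.
case/sphereSlP=> a' a'x aa' bx; have [z za' zb] := strip _ _ _ _ a'x bx.
have [z' z'a z'z] := IHi _ _ _ aa' za'.
by exists z' => //; apply/sphereSlP; exists z.
Qed.

(** Confluence at [y] swaps the two numbers of steps: a common word lies [j] duplications from [c1]
    and [i] from [c2], hence in both balls. *)
Lemma dup_correcting_del_inj (T : choiceType) l t (C : {fset seq T}) i j c1 c2 y :
  dup_correcting l t C -> i <= t -> j <= t -> c1 \in C -> c2 \in C ->
  y \in sphere (tandem_del l) i c1 -> y \in sphere (tandem_del l) j c2 ->
  c1 = c2.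
Proof.
move=> /allrelP Ccorr it jt c1C c2C; rewrite !sphere_del_dup => yc1 yc2.
have [z zc1 zc2] := dup_confluent yc1 yc2.
apply/eqP; apply: contraT => neq_c; have /implyP/(_ neq_c) := Ccorr _ _ c1C c2C.
by move/eqP/fsetP/(_ z); rewrite in_fsetI !(mem_ball _ zc1, mem_ball _ zc2).
Qed.

(** * Encoding of periodicity by blanks *)

(* [c] holds the last [size c] letters read, padded with [None]; a letter equal
   to the one [size c] places before it is replaced by [None]. *)
Fixpoint marks (T : eqType) (c : seq (option T)) (x : seq T) : seq (option T) :=
  if x is a :: x' then
    (if head None c == Some a then None else Some a)
      :: marks (rcons (behead c) (Some a)) x'
  else [::].

Lemma size_marks (T : eqType) (c : seq (option T)) x : size (marks c x) = size x.
Proof. by elim: x c => //= a x IHx c; rewrite IHx. Qed.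

(** Decoding runs from left to right: the window is known at each step, so a blank stands for its
    head. *)
Lemma marks_inj (T : eqType) (c : seq (option T)) : injective (marks c).
Proof.
move=> x; elim: x c => [|a x IHx] c [|b y] //=.
do 2!case: eqP => //.
  by move=> -> [<-] [/IHx->].
by move=> _ _ [<- /IHx->].
Qed.

Lemma marks_cat (T : eqType) (c : seq (option T)) x y : 0 < size c ->
  marks c (x ++ y) =
  marks c x ++ marks (drop (size x) (c ++ map some x)) y.
Proof.
elim: x c => [|a x IHx] [|h c] //= _; first by rewrite cats0.
by rewrite IHx ?size_rcons // cat_rcons.
Qed.

Lemma marks_repeat (T : eqType) (c : seq (option T)) v : size c = size v ->
  (marks c v == nseq (size v) None) = (c == map some v).
Proof.
(* Induction needs a window [c ++ d]: letters already read pile up in [d], and only [c] is compared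
   with [v]. *)
rewrite -{2}[c]cats0; elim: v c [::] => [|a v IHv] [|h c] d //= [sz_c].
rewrite !eqseq_cons rcons_cat IHv //.
by case: (h =P Some a).
Qed.

Definition encode (T : eqType) l (x : seq T) := marks (nseq l None) x.

(** Once [v] has been read, the window is exactly [v], so what precedes [v] no longer influences the
    code of [w]. *)
Lemma encode_cat (T : eqType) l (u v w : seq T) : 0 < l -> size v = l ->
  encode l (u ++ v ++ w) = encode l (u ++ v) ++ marks (map some v) w.
Proof.
move=> l_gt0 vl; rewrite catA /encode marks_cat ?size_nseq //.
rewrite map_cat catA drop_size_cat //.
by rewrite !size_cat size_nseq size_map vl addnC.
Qed.

Lemma encode_del (T : choiceType) l (x y : seq T) : 0 < l ->
  y \in one_error (tandem_del l) x ->
  exists u w, encode l x = u ++ nseq l None ++ w /\ encode l y = u ++ w.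
Proof.
move=> l_gt0 /one_error_delP[p /tandem_delP[u [v [w [-> _ vl ->]]]]].
exists (encode l (u ++ v)), (marks (map some v) w).
rewrite !encode_cat // marks_cat ?size_map ?vl //; split=> //; congr (_ ++ _ ++ _).
  by apply/eqP; rewrite -{1}vl marks_repeat ?size_map.
by rewrite drop_size_cat // size_map vl.
Qed.

Lemma del_encode (T : choiceType) l (x : seq T) u w : 0 < l ->
  encode l x = u ++ nseq l None ++ w ->
  exists2 y, y \in one_error (tandem_del l) x & encode l y = u ++ w.
Proof.
move=> l_gt0 xE.
have [x1 [x2 [x3 [xcat sz1 sz2]]]] :
    exists x1 x2 x3, [/\ x = x1 ++ x2 ++ x3, size x1 = size u & size x2 = l].
  have sz_x : size x = size u + (l + size w).
    by rewrite -(size_marks (nseq l None)) -/(encode l x) xE !size_cat size_nseq.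
  exists (take (size u) x), (take l (drop (size u) x)), (drop l (drop (size u) x)).
  rewrite !cat_take_drop !size_takel // ?size_drop sz_x ?addKn ?leq_addr //.
set c := drop (size x1) (nseq l None ++ map some x1).
have sz_c : size c = l by rewrite size_drop size_cat size_nseq size_map addnK.
have := xE; rewrite xcat /encode marks_cat ?size_nseq // -/c.
move/eqP; rewrite eqseq_cat ?size_marks // => /andP[/eqP uE].
rewrite marks_cat ?sz_c // eqseq_cat ?size_marks ?size_nseq // => /andP[x2E /eqP wE].
have {x2E} cE : c = map some x2.
  by apply/eqP; rewrite -marks_repeat ?sz_c ?sz2.
(* Otherwise the window would still start with the padding [None], which cannot match a letter of
   [x2]. *)
have le_l : l <= size x1.
  rewrite leqNgt; apply/negP => lt_l; move: cE.
  rewrite /c drop_cat size_nseq lt_l drop_nseq.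
  case: (l - _) (subn_gt0 (size x1) l) => [|m _]; first by rewrite lt_l.
  by case: (x2) sz2 l_gt0 => //= <-.
have x2E : x2 = drop (size x1 - l) x1.
  apply: (inj_map (@Some_inj _)); rewrite -cE /c drop_cat size_nseq ltnNge le_l.
  by rewrite map_drop.
have [x0 x1E] : exists x0, x1 = x0 ++ x2.
  by exists (take (size x1 - l) x1); rewrite x2E cat_take_drop.
exists (x1 ++ x3).
  apply/one_error_delP; exists (size x0); apply/tandem_delP.
  by exists x0, x2, x3; rewrite x1E -!catA.
rewrite -uE -wE cE drop_size_cat ?size_map // x1E -catA.
exact: encode_cat.
Qed.

(** * Inserting blanks into a fixed run *)

(** A run is addressed by the number [k] of letters before it, which removing blanks does not
    change. With fewer than [k] letters the word stays as it is. *)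
Fixpoint insert_run (T : Type) l k (e : seq (option T)) : seq (option T) :=
  match k, e with
  | 0, _ => nseq l None ++ e
  | _, [::] => [::]
  | _, None :: e' => None :: insert_run l k e'
  | k'.+1, Some a :: e' => Some a :: insert_run l k' e'
  end.

Lemma insert_run_None (T : Type) l k (e : seq (option T)) :
  insert_run l k (None :: e) = None :: insert_run l k e.
Proof. by case: k => [|k] //; case: e => [|a e] /=; elim: l => //= l ->. Qed.

Lemma insert_run_nseq (T : Type) l k m (e : seq (option T)) :
  insert_run l k (nseq m None ++ e) = nseq m None ++ insert_run l k e.
Proof. by elim: m => // m IHm; rewrite [nseq _ _]/= cat_cons insert_run_None IHm. Qed.

Lemma insert_run_inj (T : eqType) l k : injective (@insert_run T l k).
Proof.
have base : injective (@insert_run T l 0).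
  move=> e1 e2; have E (e : seq (option T)) : insert_run l 0 e = nseq l None ++ e.
    by case: e.
  by rewrite !E => /eqP; rewrite eqseq_cat // eqxx => /eqP.
move=> e1; elim: e1 k => [|[a|] e1 IH] [|k] [|[b|] e2] //; try exact: base.
  by case=> -> /IH->.
by case=> /(IH k.+1)->.
Qed.

Lemma insert_run_exists (T : Type) l (u w : seq (option T)) :
  exists k, u ++ nseq l None ++ w = insert_run l k (u ++ w).
Proof.
elim: u => [|[a|] u [k IHu]]; first by exists 0; case: w.
  by exists k.+1; rewrite /= IHu.
by exists k; rewrite cat_cons insert_run_None -IHu.
Qed.

(** Blanks within a run are interchangeable, so even when both operations hit the same run the
    removed block can be found again after the insertion. *)
Lemma insert_run_del (T : Type) l k (u w : seq (option T)) :
  exists u' w', insert_run l k (u ++ nseq l None ++ w) = u' ++ nseq l None ++ w'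
             /\ insert_run l k (u ++ w) = u' ++ w'.
Proof.
elim: u k => [|[a|] u IHu] k.
- by exists [::], (insert_run l k w); rewrite insert_run_nseq.
- case: k => [|k].
    by exists (nseq l None ++ Some a :: u), w; rewrite /= -!catA.
  by have [u' [w' [E1 E2]]] := IHu k; exists (Some a :: u'), w'; rewrite /= E1 E2.
have [u' [w' [E1 E2]]] := IHu k; exists (None :: u'), w'.
by rewrite !cat_cons !insert_run_None E1 E2.
Qed.

(** * Monotonicity of deletion spheres *)

(** With [k] the run shortened from [x] to [y], [insert_run l k] carries each chain of deletions
    from [y] to one from [x]; on codes this is an injection between the spheres. *)
Lemma card_sphere_del1 (T : choiceType) l t (x y : seq T) : 0 < l ->
  y \in one_error (tandem_del l) x ->
  #|` sphere (tandem_del l) t y| <= #|` sphere (tandem_del l) t x|.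
Proof.
move=> l_gt0 /(encode_del l_gt0)[u [w [xE yE]]].
have [k] := insert_run_exists l u w; rewrite -xE -yE => {u w yE} xE.
have lift z : z \in sphere (tandem_del l) t y ->
    exists2 z', z' \in sphere (tandem_del l) t x
              & encode l z' = insert_run l k (encode l z).
  elim: t z => [|t IHt] z; first by move/fset1P->; exists x => //; apply: fset11.
  case/sphereSrP=> z1 /IHt[z1' z1'x z1'E] /(encode_del l_gt0)[u [w [z1E zE]]].
  have [u' [w' [E1 E2]]] := insert_run_del l k u w.
  rewrite z1E E1 in z1'E; have [z' z'z1' z'E] := del_encode l_gt0 z1'E.
  by exists z'; [apply/sphereSrP; exists z1' | rewrite zE z'E].
have encI : injective (@encode T l) by apply: marks_inj.
have cardI (f : seq T -> seq (option T)) (A : {fset seq T}) : injective f ->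
    #|` [fset f z | z in A]%fset| = #|` A|.
  by move=> f_inj; rewrite card_imfset.
rewrite -(cardI _ _ (inj_comp (@insert_run_inj T l k) encI)) -[leqRHS](cardI _ _ encI).
apply: fsubset_leq_card; apply/fsubsetP => _ /imfsetP[z /= zy ->].
by have [z' z'x <-] := lift z zy; apply: in_imfset.
Qed.

Lemma card_sphere_del (T : choiceType) l s t (x y : seq T) : 0 < l ->
  y \in sphere (tandem_del l) s x ->
  #|` sphere (tandem_del l) t y| <= #|` sphere (tandem_del l) t x|.
Proof.
move=> l_gt0; elim: s x => [|s IHs] x; first by move/fset1P->.
case/sphereSlP=> z /(card_sphere_del1 t l_gt0) le_zx /IHs le_yz.
exact: leq_trans le_yz le_zx.
Qed.

Lemma size_sphere_del (T : choiceType) l t (x y : seq T) :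
  y \in sphere (tandem_del l) t x -> size x = size y + t * l.
Proof.
elim: t x => [|t IHt] x; first by move/fset1P->; rewrite addn0.
case/sphereSlP=> z /one_error_delP[p /tandem_delP[u [v [w [-> _ vl zE]]]]] /IHt.
by rewrite zE mulSn addnCA !size_cat vl => <-; rewrite addnCA.
Qed.

(** * Weights and double counting *)

Local Open Scope ring_scope.

Lemma natr_card_fset (T : choiceType) (A : {fset T}) (P : pred T) :
  #|` [fset x in A | P x]%fset|%:R = \sum_(x <- A) (P x)%:R :> rat.
Proof.
rewrite card_fset_sum1 -big_fset_condE natr_sum big_mkcond.
by apply: eq_bigr => x _; case: (P x).
Qed.

Lemma ler_sum_mem (I : eqType) (r : seq I) (F : I -> rat) i :
  i \in r -> (forall j, 0 <= F j) -> F i <= \sum_(j <- r) F j.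
Proof. by move=> ir F_ge0; rewrite (big_rem i) //= lerDl sumr_ge0. Qed.

Lemma sphere_del_words q l t n (c y : seq 'Z_q) :
  c \in words q n%:Z -> y \in sphere (tandem_del l) t c ->
  y \in words q (n%:Z - (t * l)%:Z).
Proof.
rewrite !in_words eqz_nat => /eqP <- /size_sphere_del->.
by rewrite PoszD addrK.
Qed.

(* The two weights never add up on a word: an irreducible word has an empty
   sphere, and [0^-1 = 0]. *)
Lemma ball_weight_ge1 q l t n (c : seq 'Z_q) : (0 < l)%N ->
  c \in words q n%:Z ->
  1 <= \sum_(0 <= i < t.+1) \sum_(y <- words q (n%:Z - (i * l)%:Z))
         (y \in IRR l t)%:R * (y \in sphere (tandem_del l) i c)%:R
       + \sum_(y <- words q (n%:Z - (t * l)%:Z))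
         #|` sphere (tandem_del l) t y|%:R^-1
           * (y \in sphere (tandem_del l) t c)%:R :> rat.
Proof.
move=> l_gt0 cn; have natM_ge0 (b1 b2 : bool) : 0 <= b1%:R * b2%:R :> rat.
  by rewrite mulr_ge0 ?ler0n.
(* An irreducible word within [t] deletions of [c] already contributes 1 to the first sum. *)
have [/hasP[i it /hasP[y yc y_irr]]|/hasPn red] := boolP (has (fun i =>
    has (IRR l t) (sphere (tandem_del l) i c)) (iota 0 t.+1)).
  apply: (@le_trans _ _ (\sum_(0 <= i < t.+1) \sum_(y <- words q (n%:Z - (i * l)%:Z))
         (y \in IRR l t)%:R * (y \in sphere (tandem_del l) i c)%:R)); last first.
    by rewrite lerDl sumr_ge0 // => z _; rewrite mulr_ge0 ?invr_ge0 ?ler0n.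
  have it' : i \in index_iota 0 t.+1 by rewrite /index_iota subn0.
  apply: le_trans (ler_sum_mem it' _) => [|j]; last by apply: sumr_ge0.
  apply: le_trans (ler_sum_mem (sphere_del_words cn yc) _) => // /=.
  by rewrite yc (y_irr : y \in IRR l t) mulr1.
have {}red i y : (i <= t)%N -> y \in sphere (tandem_del l) i c ->
    (0 < #|` sphere (tandem_del l) t y|)%N.
  move=> it yc; rewrite cardfs_gt0; apply: contra (red i _); last first.
    by rewrite mem_iota.
  by move=> y_irr; apply/hasP; exists y.
have c_gt0 := red 0 c isT (fset11 c).
apply: ler_wpDl; first by rewrite sumr_ge0 // => i _; apply: sumr_ge0.
have cardE : #|` sphere (tandem_del l) t c|%:R =
    \sum_(y <- words q (n%:Z - (t * l)%:Z)) (y \in sphere (tandem_del l) t c)%:R :> rat.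
  rewrite -natr_card_fset; congr (#|` _|)%:R; apply/fsetP => y.
  rewrite !inE /=; case yc: (y \in sphere _ _ _); rewrite ?andbF ?andbT //.
  by rewrite (sphere_del_words cn yc).
(* Now 1 is split into equal shares over the sphere of [c]. Each [y] there has a nonempty sphere no
   larger than that of [c], so its weight is at least one share. *)
rewrite -[leLHS](@mulVf _ #|` sphere (tandem_del l) t c|%:R) ?pnatr_eq0 -?lt0n //.
rewrite {2}cardE mulr_sumr ler_sum // => y _.
case yc: (y \in _); last by rewrite !mulr0.
have y_gt0 := red t y (leqnn t) yc.
rewrite !mulr1 lef_pV2 ?posrE ?ltr0n // ler_nat.
exact: card_sphere_del yc.
Qed.

Lemma sum_code_le1 (T : choiceType) l t i (C : {fset seq T}) y :
  dup_correcting l t C -> (i <= t)%N ->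
  \sum_(c <- C) (y \in sphere (tandem_del l) i c)%:R <= 1 :> rat.
Proof.
move=> Ccorr it; rewrite -natr_card_fset (ler_nat _ _ 1).
set A := [fset _ in _ | _]%fset; have [->|[c]] := fset_0Vmem A.
  by rewrite cardfs0.
rewrite !inE /= => /andP[cC yc]; rewrite -(cardfs1 c); apply: fsubset_leq_card.
apply/fsubsetP => c'; rewrite !inE /= => /andP[c'C yc']; apply/eqP.
exact: (dup_correcting_del_inj Ccorr it it c'C cC yc' yc).
Qed.

Lemma sum_inv_del_sphere q l t (m : int) :
  \sum_(y <- words q m) #|` sphere (tandem_del l) t y|%:R^-1 =
  \sum_(1 <= i < (max_del_sphere q l t m).+1)
    (del_sphere_count q l t m i)%:R / i%:R :> rat.
Proof.
under [RHS]eq_bigr do rewrite natr_card_fset mulr_suml.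
rewrite exchange_big /= !big_seq; apply: eq_bigr => y yW.
(* Words with an empty sphere have weight [0^-1 = 0], so the sum over sizes may start at 1. *)
set k := #|` _|; have [k0|k_gt0] := posnP k.
  rewrite k0 invr0 big_nat big1 // => i /andP[i_gt0 _].
  by rewrite eq_sym gtn_eqF ?mul0r.
have k_le : (k <= max_del_sphere q l t m)%N.
  by apply: (leq_bigmax_seq (F := fun x : seq 'Z_q => #|` sphere (tandem_del l) t x|)).
rewrite (bigD1_seq k) ?iota_uniq ?mem_index_iota ?k_gt0 //= eqxx mul1r.
by rewrite big1 ?addr0 // => i; rewrite eq_sym => /negPf->; rewrite mul0r.
Qed.

(** Sum the ball weights over all codewords and exchange the sums: for each number of deletions, a
    word is charged to at most one codeword. *)
Lemma card_code_le q l t n (C : {fset seq 'Z_q}) : (0 < l)%N ->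
  (C `<=` words q n%:Z)%fset -> dup_correcting l t C ->
  #|` C|%:R <=
    \sum_(0 <= i < t.+1) (irr_count q l t (n%:Z - (i * l)%:Z))%:R
    + \sum_(1 <= i < (max_del_sphere q l t (n%:Z - (t * l)%:Z)).+1)
        (del_sphere_count q l t (n%:Z - (t * l)%:Z) i)%:R / i%:R :> rat.
Proof.
move=> l_gt0 /fsubsetP Cn Ccorr; rewrite card_fset_sum1 natr_sum big_seq.
apply: le_trans (ler_sum _ (fun c cC => ball_weight_ge1 t l_gt0 (Cn c cC))) _.
rewrite -big_seq big_split /= -sum_inv_del_sphere; apply: lerD.
  rewrite exchange_big /= !big_nat ler_sum // => i /andP[_ it].
  rewrite exchange_big /irr_count natr_card_fset ler_sum //= => y _.
  by rewrite -mulr_sumr ler_piMr ?ler0n // (sum_code_le1 _ Ccorr).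
rewrite exchange_big ler_sum //= => y _.
by rewrite -mulr_sumr ler_piMr ?invr_ge0 ?ler0n // (sum_code_le1 _ Ccorr).
Qed.

Theorem corollary1 (q l t n : nat)
    (hq : (2 <= q)%N) (hl : (1 <= l)%N) (ht : (1 <= t)%N) (hn : (1 <= n)%N) :
  (max_code_size q l n t)%:R <=
    \sum_(0 <= i < t.+1) (irr_count q l t (n%:Z - (i * l)%:Z))%:R
    + \sum_(1 <= i < (max_del_sphere q l t (n%:Z - (t * l)%:Z)).+1)
        (del_sphere_count q l t (n%:Z - (t * l)%:Z) i)%:R / i%:R :> rat.
Proof.
(* The bound passes through the maximum; its nonnegativity covers the default value 0. *)
rewrite /max_code_size big_seq_cond; elim/big_ind: _ => [|a b|C].
- by rewrite addr_ge0 // sumr_ge0 // => i _; rewrite ?divr_ge0 ?ler0n.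
- by rewrite /maxn; case: ifP.
by rewrite fpowersetE => /andP[]; apply: card_code_le.
Qed.
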